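(* Let $m=m(n)$ be positive integers with $m=O(n)$, let $G=G(n,m)$ be a graph chosen uniformly at random from all simple graphs on vertex set $[n]=\{1,\dots,n\}$ with $m$ edges, and let $\mathbf d=(d_G(1),\dots,d_G(n))$ be its degree sequence. Throw $2m$ balls independently and uniformly at random into $n$ bins $B_1,\dots,B_n$, and let $\mathbf L=(L_1,\dots,L_n)$ be the vector of loads, where $L_j$ is the number of balls in $B_j$. Let $\varepsilon>0$. Then: (i) $\mathbf d$ is contiguous with respect to $\mathbf L$, i.e. for every sequence of sets $I=I(n)\subseteq\{0,1,\dots,2m\}^n$, if $\Pr[\mathbf L\in I]\to1$ as $n\to\infty$, then $\Pr[\mathbf d\in I]\to1$; (ii) with probability tending to $1$, $\lfloor \nu(n,2m)-\varepsilon\rfloor\le \Delta(G)\le \lfloor \nu(n,2m)+\varepsilon\rfloor$.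
   Context: $\Delta(G)$ is the maximum degree of $G$; $\log$ is the natural logarithm. For $n,k\in\mathbb N$, $\nu(n,k)$ is the unique positive zero of $f_{n,k}(x)=x\log k+x-(x+1/2)\log x-(x-1)\log n$. *)

(* Defs.v *)
From HB Require Import structures.
From mathcomp Require Import all_boot all_order all_algebra.
From mathcomp Require Import all_classical all_reals all_analysis.
From mathcomp Require Import ring lra.

Set Implicit Arguments.
Unset Strict Implicit.
Unset Printing Implicit Defensive.

Import Order.TTheory GRing.Theory Num.Theory.
Import numFieldNormedType.Exports.

Local Open Scope ring_scope.
Local Open Scope classical_set_scope.

(* The junk value 0 is taken when Omega is empty, as for graphs on n vertices
   with more than 'C(n, 2) edges. *)
Definition unif_prob (R : realType) (T : finType) (Omega : {set T})
    (A : pred T) : R :=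
  #|[pred x in Omega | A x]|%:R / #|Omega|%:R.

(* A simple graph on the vertex set 'I_n is identified with its edge set, a set
   of two-element subsets of 'I_n. *)
Definition graphs (n m : nat) : {set {set {set 'I_n}}} :=
  [set E : {set {set 'I_n}} |
    [forall e in E, #|e| == 2%N] && (#|E| == m)]%SET.

Definition degree (n : nat) (E : {set {set 'I_n}}) (v : 'I_n) : nat :=
  #|[pred e in E | v \in (e : {set 'I_n})]|.

Definition degree_sequence (n : nat) (E : {set {set 'I_n}}) :
    {ffun 'I_n -> nat} :=
  [ffun v => degree E v].

Definition max_degree (n : nat) (E : {set {set 'I_n}}) : nat :=
  (\max_(v < n) degree E v)%N.

(* Throwing k balls independently and uniformly into n bins amounts to choosing
   the function ball |-> bin uniformly in {ffun 'I_k -> 'I_n}. *)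
Definition throws (k n : nat) : {set {ffun 'I_k -> 'I_n}} :=
  [set: {ffun 'I_k -> 'I_n}]%SET.

Definition loads (k n : nat) (b : {ffun 'I_k -> 'I_n}) : {ffun 'I_n -> nat} :=
  [ffun j => #|[pred i | b i == j]|].

Definition nu_fun (R : realType) (n k : nat) (x : R) : R :=
  x * ln k%:R + x - (x + 1 / 2) * ln x - (x - 1) * ln n%:R.

(* nu_fun n k has exactly one positive zero when n, k > 0: see nuP. *)
Definition nu (R : realType) (n k : nat) : R :=
  xget 0 [set x : R | 0 < x /\ nu_fun n k x = 0].

(* nu_fun n k x / x is strictly decreasing. *)
Lemma nu_fun_cross (R : realType) (n k : nat) (x y : R) :
  (0 < n)%N -> 0 < x -> x < y -> x * nu_fun n k y < y * nu_fun n k x.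
Proof.
move=> n_gt0 x0 xy; have y0 : 0 < y by apply: lt_trans xy.
have lnn : 0 <= ln (n%:R : R) by apply: ln_ge0; rewrite ler1n.
have lnx : ln x <= x - 1.
  by have := @le_ln1Dx R (x - 1); rewrite subrKC; apply; lra.
have t_ge : y - x <= y * (ln y - ln x).
  have xy0 : 0 < x / y by rewrite divr_gt0.
  have := @le_ln1Dx R (x / y - 1); rewrite subrKC ln_div ?posrE// => H.
  have {H} : ln x - ln y <= x / y - 1 by apply: H; lra.
  rewrite -(ler_pM2l y0) mulrBr mulrBr mulr1 mulrCA divff ?gt_eqF//.
  by rewrite mulr1; lra.
have lnxy : ln x < ln y by rewrite ltr_ln ?posrE.
rewrite -subr_gt0 /nu_fun.
set lx := ln x in lnx t_ge lnxy *; set ly := ln y in t_ge lnxy *.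
set N := ln n%:R in lnn *; set K := ln _.
have -> : y * (x * K + x - (x + 1 / 2) * lx - (x - 1) * N) -
   x * (y * K + y - (y + 1 / 2) * ly - (y - 1) * N) =
   x * (y * (ly - lx) - (y - x)) + x * (ly - lx) / 2
   + (y - x) * (x - 1 - lx) / 2 + (y - x) * (x + 1) / 2 + (y - x) * N.
  by field.
have h1 : 0 <= x * (y * (ly - lx) - (y - x)).
  by rewrite mulr_ge0 ?subr_ge0 // ltW.
have h2 : 0 < x * (ly - lx) by rewrite mulr_gt0 ?subr_gt0.
have h3 : 0 <= (y - x) * (x - 1 - lx) by rewrite mulr_ge0 ?subr_ge0 // ltW.
have h4 : 0 < (y - x) * (x + 1) by rewrite mulr_gt0 ?subr_gt0 ?addr_gt0.
have h5 : 0 <= (y - x) * N by rewrite mulr_ge0 ?subr_ge0 // ltW.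
lra.
Qed.

Lemma nu_fun_ex (R : realType) (n k : nat) :
  (0 < n)%N -> (0 < k)%N -> exists x : R, 0 < x /\ nu_fun n k x = 0.
Proof.
move=> n_gt0 k_gt0.
have lnn : 0 <= ln (n%:R : R) by apply: ln_ge0; rewrite ler1n.
have k1 : 1 <= k%:R :> R by rewrite ler1n.
have lnk : 0 <= ln (k%:R : R) by exact: ln_ge0.
pose b : R := k%:R * expR 1.
have e1 : 1 <= expR 1 :> R by rewrite ltW// expR_gt1.
have b1 : 1 <= b by rewrite /b -[leLHS]mulr1 ler_pM.
have lnb : ln b = ln k%:R + 1.
  by rewrite lnM ?posrE ?expR_gt0 ?expRK// ltr0n.
have f1 : 0 <= nu_fun n k (1 : R) by rewrite /nu_fun ln1; lra.
have fb : nu_fun n k b <= 0.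
  rewrite /nu_fun lnb.
  have h : 0 <= (b - 1) * ln n%:R by rewrite mulr_ge0 // subr_ge0.
  lra.
have cf : {within `[1, b], continuous (@nu_fun R n k)}.
  apply: continuous_in_subspaceT => x; rewrite inE/= in_itv/= => /andP[x1 _].
  have x0 : 0 < x by apply: lt_le_trans x1.
  have cl := continuous_ln x0.
  apply: cvgB; last by apply: cvgMl; apply: cvgB => //; exact: cvg_cst.
  apply: cvgB; last first.
    by apply: cvgM => //; apply: cvgD => //; exact: cvg_cst.
  by apply: cvgD => //; apply: cvgMl.
have [|c] := IVT b1 cf (v := 0).
  by rewrite ge_min le_max f1 fb orbT.
by rewrite in_itv/= => /andP[c1 _] fc; exists c; split=> //; apply: lt_le_trans c1.
Qed.

Lemma nuP (R : realType) (n k : nat) : (0 < n)%N -> (0 < k)%N ->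
  [/\ 0 < nu R n k, nu_fun n k (nu R n k) = 0
    & forall x : R, 0 < x -> nu_fun n k x = 0 -> x = nu R n k].
Proof.
move=> n_gt0 k_gt0.
have [nu0 fnu] := xgetPex 0 (@nu_fun_ex R _ _ n_gt0 k_gt0); rewrite -/(nu R n k) in nu0 fnu.
split=> // x x0 fx; apply/eqP; case: ltgtP => // lt.
- by have := nu_fun_cross k n_gt0 x0 lt; rewrite fx fnu !mulr0 ltxx.
- by have := nu_fun_cross k n_gt0 nu0 lt; rewrite fx fnu !mulr0 ltxx.
Qed.

(* Main.v *)
Require Import Defs.
From HB Require Import structures.
From mathcomp Require Import all_boot all_order all_algebra.
From mathcomp Require Import all_classical all_reals all_analysis.
From mathcomp Require Import ring lra zify.

Set Implicit Arguments.
Unset Strict Implicit.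
Unset Printing Implicit Defensive.

Import Order.TTheory GRing.Theory Num.Theory.
Import numFieldNormedType.Exports.

(** Reading the 2m balls two by two as the endpoints of m edges turns a throw
    into a multigraph whose degree sequence is the load vector. Every simple
    graph with m edges arises from exactly m! 2^m throws, and the throws giving
    a simple graph have probability prod_(i < m) (1 - 1/n - 2i/n^2), which is
    bounded away from 0 when m = O(n). Hence
    Pr[d notin I] <= C Pr[L notin I] for every I, which gives (i).

    By (i), it suffices for (ii) to study the maximum load of k = 2m balls. By
    Stirling's formula, exp (f_{n,k} x) is, up to a constant factor, the mean
    n (k/n)^x / x! of the number of bins of load x. Since f_{n,k}(x)/x decreases
    at rate at least (ln n)/x^2 and nu(n,k) = o(ln n), f_{n,k} tends to -oo at
    the integers above nu + eps and to +oo at those in [2, nu - eps]. The upper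
    bound is then a union bound, and the lower bound is Chebyshev's inequality
    for the number of bins of load exactly x. *)

(** * Exact counts of throws with prescribed loads *)

Section LoadCounts.
Local Open Scope nat_scope.
Local Open Scope set_scope.

Lemma card_ffun_family (aT rT : finType) (F : aT -> {set rT}) :
  #|[set b : {ffun aT -> rT} | [forall i, b i \in F i]]| = \prod_i #|F i|.
Proof.
rewrite cardsE.
have -> : #|[pred b : {ffun aT -> rT} | [forall i, b i \in F i]]| =
          #|(family (fun i => mem (F i)) : simpl_pred {ffun aT -> rT})|.
  by apply: eq_card => b; rewrite !inE.
by rewrite card_family foldrE big_map big_enum.
Qed.

(** Choosing a throw ball by ball, a ball in [S] is forced and any other ball has [c] choices. The
    three fibre counts below differ only in [c]: n, n - 1 and n - 2. *)
Lemma prodn_outside k (S : {set 'I_k}) (c : nat) :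
  \prod_i (if i \in S then 1 else c) = c ^ (k - #|S|).
Proof.
rewrite (bigID (mem S)) /= big1 ?mul1n; last by move=> i ->.
rewrite (eq_bigr (fun=> c)); last by move=> i /negbTE ->.
rewrite (eq_bigl (mem (~: S))); last by move=> i; rewrite /= inE.
by rewrite prod_nat_const cardsCs finset.setCK card_ord.
Qed.

Definition balls_in (k n : nat) (b : {ffun 'I_k -> 'I_n}) (j : 'I_n) : {set 'I_k} :=
  [set i | b i == j].

Lemma loadsE k n (b : {ffun 'I_k -> 'I_n}) j : loads b j = #|balls_in b j|.
Proof. by rewrite ffunE cardsE. Qed.

Lemma card_balls_in_sup k n (S : {set 'I_k}) (j : 'I_n) :
  #|[set b : {ffun 'I_k -> 'I_n} | S \subset balls_in b j]| = n ^ (k - #|S|).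
Proof.
rewrite -prodn_outside.
rewrite (eq_bigr (fun i => #|if i \in S then [set j] else [set: 'I_n]|)).
  rewrite -card_ffun_family; apply: eq_card => b; rewrite !inE.
  apply/fintype.subsetP/forallP => [h i|h i iS].
    by have := h i; case: (i \in S) => [/(_ isT)|_]; rewrite !inE.
  by have := h i; rewrite iS !inE.
by move=> i _; case: ifP; rewrite ?cards1 ?cardsT ?card_ord.
Qed.

Lemma card_balls_in_eq k n (S : {set 'I_k}) (j : 'I_n) :
  #|[set b : {ffun 'I_k -> 'I_n} | balls_in b j == S]| = n.-1 ^ (k - #|S|).
Proof.
rewrite -prodn_outside.
rewrite (eq_bigr (fun i => #|if i \in S then [set j] else [set~ j]|)).
  rewrite -card_ffun_family; apply: eq_card => b; rewrite !inE.
  apply/eqP/forallP => [<- i|h].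
    by rewrite !inE; case: ifP; rewrite !inE => ->.
  by apply/setP => i; have := h i; rewrite !inE; case: ifP; rewrite !inE // => _ /negbTE.
by move=> i _; case: ifP; rewrite ?cards1 ?cardsC1 ?card_ord.
Qed.

Lemma card_balls_in_eq2 k n (S T : {set 'I_k}) (j l : 'I_n) :
  j != l -> T \subset ~: S ->
  #|[set b : {ffun 'I_k -> 'I_n} | (balls_in b j == S) && (balls_in b l == T)]| =
  (n - 2) ^ (k - #|S| - #|T|).
Proof.
move=> jl dST.
have cST : #|S :|: T| = #|S| + #|T|.
  by apply/eqP; rewrite (leq_card_setU S T) disjoint_sym finset.disjoints_subset.
rewrite -subnDA -cST -prodn_outside.
pose F i := if i \in S then [set j] else if i \in T then [set l] else ~: [set j; l].
rewrite (eq_bigr (fun i => #|F i|)).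
  rewrite -card_ffun_family; apply: eq_card => b; rewrite !inE /F.
  apply/andP/forallP => [[/eqP bS /eqP bT] i|h].
    rewrite -bS -bT !inE; have [->|bj] := eqVneq (b i) j; first by rewrite !inE.
    by have [->|bl] := eqVneq (b i) l; rewrite !inE // (negbTE bj) (negbTE bl).
  split; apply/eqP/setP => i; have := h i; rewrite !inE.
    case: ifP; rewrite ?inE // => _; case: ifP => _; rewrite ?inE.
      by move=> /eqP ->; rewrite eq_sym (negbTE jl).
    by rewrite negb_or => /andP[/negbTE].
  case: ifP => iS; rewrite ?inE.
    move=> /eqP ->; rewrite (negbTE jl).
    by apply/esym/negbTE/(contraL _ iS) => /(fintype.subsetP dST); rewrite inE.
  by case: ifP => _; rewrite ?inE // negb_or => /andP[_ /negbTE].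
move=> i _; rewrite /F finset.in_setU; case: (i \in S); first by rewrite cards1.
case: (i \in T); first by rewrite cards1.
by rewrite cardsCs finset.setCK cards2 jl card_ord.
Qed.

Lemma card_load_eq k n x (j : 'I_n) :
  #|[set b : {ffun 'I_k -> 'I_n} | #|balls_in b j| == x]| = 'C(k, x) * n.-1 ^ (k - x).
Proof.
rewrite -sum1dep_card (partition_big (fun b => balls_in b j) (fun S => #|S| == x)) //=.
rewrite (eq_bigr (fun=> n.-1 ^ (k - x))) => [|S /eqP Sx].
  by rewrite sum_nat_const -cardsE card_draws card_ord.
rewrite -[in RHS]Sx -(card_balls_in_eq S j) -sum1dep_card; apply: eq_bigl => b.
by have [->|] := eqVneq (balls_in b j) S; rewrite ?Sx ?eqxx ?andbF.
Qed.

Lemma card_load_eq2 k n x (j l : 'I_n) : j != l ->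
  #|[set b : {ffun 'I_k -> 'I_n} | (#|balls_in b j| == x) && (#|balls_in b l| == x)]| =
  'C(k, x) * ('C(k - x, x) * (n - 2) ^ (k - x - x)).
Proof.
move=> jl; rewrite -sum1dep_card.
rewrite (partition_big (fun b => balls_in b j) (fun S => #|S| == x)) => [|b /andP[]//].
rewrite (eq_bigr (fun=> 'C(k - x, x) * (n - 2) ^ (k - x - x))) => [|S /eqP Sx].
  by rewrite sum_nat_const -cardsE card_draws card_ord.
rewrite (partition_big (fun b => balls_in b l) (fun T => (T \subset ~: S) && (#|T| == x))).
  rewrite (eq_bigr (fun=> (n - 2) ^ (k - x - x))) => [|T /andP[TS /eqP Tx]].
    rewrite sum_nat_const -cardsE cards_draws.
    by rewrite cardsCs finset.setCK Sx card_ord.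
  have -> : k - x - x = k - #|S| - #|T| by rewrite Sx Tx.
  rewrite -(card_balls_in_eq2 jl TS) -sum1dep_card.
  apply: eq_bigl => b.
  have [->|] := eqVneq (balls_in b j) S; rewrite ?andbF //=.
  by have [->|] := eqVneq (balls_in b l) T; rewrite ?Sx ?Tx ?eqxx ?andbF.
move=> b /andP[/andP[_ ->] /eqP <-]; rewrite andbT.
by apply/fintype.subsetP => i; rewrite !inE => /eqP ->; rewrite eq_sym.
Qed.

(** Union bound over the bins [j] and the [x]-element sets [S] of balls lying in [j]: a bin with at
    least [x] balls contains such an [S]. *)
Lemma card_load_ge k n x :
  #|[set b : {ffun 'I_k -> 'I_n} | [exists j, x <= #|balls_in b j|]]| <=
  n * ('C(k, x) * n ^ (k - x)).
Proof.
pose sup j (S : {set 'I_k}) := [set b : {ffun 'I_k -> 'I_n} | S \subset balls_in b j].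
apply: (@leq_trans (\sum_(j < n) \sum_(S : {set 'I_k} | #|S| == x) #|sup j S|)).
  under [X in _ <= X]eq_bigr do under eq_bigr do rewrite -sum1dep_card.
  under [X in _ <= X]eq_bigr do rewrite (exchange_big_dep predT) //=.
  rewrite exchange_big /= -sum1dep_card [X in X <= _]big_mkcond /=.
  apply: leq_sum => b _; case: ifP => // /existsP[j xj].
  have : 0 < #|[set S : {set 'I_k} | S \subset balls_in b j & #|S| == x]|.
    by rewrite cards_draws bin_gt0.
  case/card_gt0P => S; rewrite inE => /andP[Sb Sx].
  by rewrite (bigD1 j) //= (bigD1 S) ?Sx //= addn_gt0.
rewrite (eq_bigr (fun=> 'C(k, x) * n ^ (k - x))) => [|j _].
  by rewrite sum_nat_const card_ord.
rewrite (eq_bigr (fun=> n ^ (k - x))) => [|S /eqP Sx].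
  by rewrite sum_nat_const -cardsE card_draws card_ord.
by rewrite card_balls_in_sup Sx.
Qed.

(** After division by powers of n and n - 1: two distinct bins both have load [x] with probability
    at most (n/(n-1))^(2x) times the square of the probability for one bin. It rests on C(k-x, x) <=
    C(k, x) and n(n-2) <= (n-1)^2. *)
Lemma load_pair_correlation k n x : 1 < n ->
  ('C(k, x) * ('C(k - x, x) * (n - 2) ^ (k - x - x))) * n ^ k * n.-1 ^ (2 * x)
  <= ('C(k, x) * n.-1 ^ (k - x)) ^ 2 * n ^ (2 * x).
Proof.
move=> n1; have [lt|le] := ltnP (k - x) x.
  by rewrite (bin_small lt) mul0n muln0 !mul0n.
have le_bin : 'C(k - x, x) <= 'C(k, x) by apply: leq_bin2l; rewrite leq_subr.
set r := k - x - x; have kE : k = r + (2 * x) by rewrite /r; lia.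
have kx : k - x = r + x by rewrite /r; lia.
have sq : (n - 2) ^ r * n ^ r <= n.-1 ^ (2 * r).
  rewrite -expnMn expnM; case: (r) => [|r']; first by rewrite !expn0.
  by rewrite leq_exp2r // -mulnn; nia.
have sq' : 'C(k, x) * 'C(k - x, x) <= 'C(k, x) ^ 2 by rewrite -mulnn leq_mul2l le_bin orbT.
have -> : n ^ k = n ^ r * n ^ (2 * x) by rewrite -expnD -kE.
have -> : n.-1 ^ (k - x) = n.-1 ^ r * n.-1 ^ x by rewrite -expnD -kx.
have -> : 'C(k, x) * ('C(k - x, x) * (n - 2) ^ r) * (n ^ r * n ^ (2 * x)) * n.-1 ^ (2 * x)
  = ('C(k, x) * 'C(k - x, x)) * ((n - 2) ^ r * n ^ r) * (n ^ (2 * x) * n.-1 ^ (2 * x)).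
  by ring.
apply: (@leq_trans ('C(k, x) ^ 2 * n.-1 ^ (2 * r) * (n ^ (2 * x) * n.-1 ^ (2 * x)))).
  by rewrite leq_mul2r leq_mul ?orbT.
rewrite !(mulnC 2) !expnM leq_eqVlt; apply/orP; left; apply/eqP.
by rewrite !expnMn; ring.
Qed.
End LoadCounts.

(** * Throws built from graphs by numbering and orienting the edges *)

Section Orientations.
Local Open Scope nat_scope.
Local Open Scope set_scope.

Lemma card_half_edges m : #|{: 'I_m * bool}| = 2 * m.
Proof. by rewrite card_prod card_ord card_bool mulnC. Qed.

(** The first component is the index of an edge, the second one of its two ends. The enumeration
    behind this bijection is arbitrary; only its invertibility is used. *)
Definition half_edge m (i : 'I_(2 * m)) : 'I_m * bool :=
  enum_val (cast_ord (esym (card_half_edges m)) i).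

Definition half_edge_inv m (p : 'I_m * bool) : 'I_(2 * m) :=
  cast_ord (card_half_edges m) (enum_rank p).

Lemma half_edge_invK m : cancel (@half_edge_inv m) (@half_edge m).
Proof. by move=> p; rewrite /half_edge /half_edge_inv cast_ordK enum_rankK. Qed.

Lemma half_edgeK m : cancel (@half_edge m) (@half_edge_inv m).
Proof. by move=> p; rewrite /half_edge /half_edge_inv enum_valK cast_ordKV. Qed.

Variables (n m : nat) (x0 : 'I_n).

(* [x0] is only a default value: it is never reached when [#|e| = 2]. *)
Definition endpoint (e : {set 'I_n}) (c : bool) : 'I_n := nth x0 (enum e) c.

Lemma endpoints_edge (e : {set 'I_n}) : #|e| = 2 ->
  endpoint e false != endpoint e true /\
  [set endpoint e false; endpoint e true] = e.
Proof.
rewrite /endpoint cardE => se; have := enum_uniq e; have := set_enum e.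
case: (enum e) se => [|a [|b []]] //= _ <-; rewrite inE andbT => ->; split=> //.
by apply/setP => z; rewrite !inE.
Qed.

Lemma sum_endpoints (e : {set 'I_n}) (o : bool) (v : 'I_n) : #|e| = 2 ->
  \sum_(c : bool) (endpoint e (o (+) c) == v) = (v \in e).
Proof.
move=> /endpoints_edge[ne eE]; rewrite -[in RHS]eE big_bool !inE !(eq_sym v).
by case: o => /=; case: eqP => // fv; case: eqP => // tv; move: ne; rewrite fv tv eqxx.
Qed.

(* The throw that lists the endpoints of the edges [f i] one after the other,
   the edge [f i] being reversed when [o i] holds. *)
Definition throw_of (f : {ffun 'I_m -> {set 'I_n}}) (o : {ffun 'I_m -> bool}) :
    {ffun 'I_(2 * m) -> 'I_n} :=
  [ffun i => endpoint (f (half_edge i).1) (o (half_edge i).1 (+) (half_edge i).2)].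

(** Group the half-edges at [v] by their edge: each edge contributes one exactly when it contains
    [v], whatever its orientation. Injectivity of [f] lets edges be counted by their indices. *)
Lemma loads_throw_of (f : {ffun 'I_m -> {set 'I_n}}) o : injective f -> (forall i, #|f i| = 2) ->
  loads (throw_of f o) = degree_sequence (f @: [set: 'I_m]).
Proof.
move=> inj_f f2; apply/ffunP => v; rewrite !ffunE /degree.
have -> : #|[pred i | throw_of f o i == v]| =
    \sum_(p : 'I_m * bool) (endpoint (f p.1) (o p.1 (+) p.2) == v).
  rewrite -sum1_card big_mkcond (reindex (@half_edge_inv m)) /=; last first.
    by exists (@half_edge m) => ? _; [exact: half_edge_invK|exact: half_edgeK].
  by apply: eq_bigr => p _; rewrite inE ffunE half_edge_invK; case: eqP.
rewrite -(pair_bigA _ (fun i c => (endpoint (f i) (o i (+) c) == v) : nat)) /=.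
rewrite (eq_bigr (fun i => (v \in f i) : nat)) => [|i _]; last exact: sum_endpoints.
have -> : \sum_i (v \in f i) = #|[set i | v \in f i]|.
  by rewrite -sum1dep_card [RHS]big_mkcond; apply: eq_bigr => i _; case: (v \in _).
rewrite -(card_imset _ inj_f); apply: eq_card => e; rewrite !inE.
apply/imsetP/andP => [[i]|[/imsetP[i _ ->] vi]].
  by rewrite inE => vi ->; split=> //; apply: imset_f; rewrite inE.
by exists i; rewrite ?inE.
Qed.

(** The two values at the half-edges of [i] recover the edge [f i] as a set; since they differ, the
    first one then recovers the bit [o i]. *)
Lemma throw_of_inj (f f' : {ffun 'I_m -> {set 'I_n}}) o o' :
  (forall i, #|f i| = 2) -> (forall i, #|f' i| = 2) ->
  throw_of f o = throw_of f' o' -> (f, o) = (f', o').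
Proof.
move=> f2 f2' /ffunP eq_b.
have eq_pt i c : endpoint (f i) (o i (+) c) = endpoint (f' i) (o' i (+) c).
  by have := eq_b (half_edge_inv (i, c)); rewrite !ffunE half_edge_invK.
have edge_pts (e : {set 'I_n}) (c : bool) : #|e| = 2 ->
    e = [set endpoint e (c (+) false); endpoint e (c (+) true)].
  move=> /endpoints_edge[_ eE]; case: c => /=; last exact: esym.
  by rewrite finset.setUC.
have eq_f : f = f'.
  apply/ffunP => i; rewrite (edge_pts (f i) (o i)) // !eq_pt.
  exact/esym/edge_pts.
congr pair => //; apply/ffunP => i; have := eq_pt i false; rewrite -eq_f !addbF.
have [/eqP ne _] := endpoints_edge (f2 i).
by case: (o i); case: (o' i) => // ept; case: ne.
Qed.

Definition edge_lists : {set {ffun 'I_m -> {set 'I_n}}} :=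
  [set f in ffun_on [pred e : {set 'I_n} | #|e| == 2] | injectiveb f].

Lemma edge_listsP (f : {ffun 'I_m -> {set 'I_n}}) :
  reflect (injective f /\ forall i, #|f i| = 2) (f \in edge_lists).
Proof.
rewrite inE; apply: (iffP andP) => [[/ffun_onP f2 /injectiveP //]|[f_inj f2]].
  by split=> // i; apply/eqP; exact: (f2 i).
by split; [apply/ffun_onP => i; rewrite inE f2|apply/injectiveP].
Qed.

(** An injection of ['I_m] into the [m]-element set [E] is onto, so these lists are all the
    injections into [E]. *)
Lemma card_edge_lists_of (E : {set {set 'I_n}}) : E \in graphs n m ->
  #|[set f in edge_lists | f @: [set: 'I_m] == E]| = m`!.
Proof.
rewrite inE => /andP[/'forall_implyP E2 /eqP Em].
rewrite -ffactnn -[in X in X ^_ _]Em -[in X in _ ^_ X](card_ord m).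
rewrite -(card_inj_ffuns_on _ (mem E)); apply: eq_card => f.
rewrite !inE; apply/andP/andP => [[/andP[_ ->] /eqP <-]|[/ffun_onP fE inj_f]].
  by split=> //; apply/ffun_onP => i; apply: imset_f; rewrite inE.
rewrite inj_f andbT; split.
  by apply/ffun_onP => i; rewrite inE; apply: E2; exact: (fE i).
rewrite eqEcard (card_imset _ (injectiveP _ inj_f)) cardsT card_ord Em leqnn andbT.
by apply/fintype.subsetP => _ /imsetP[i _ ->]; exact: fE.
Qed.

Lemma edge_list_graph (f : {ffun 'I_m -> {set 'I_n}}) :
  f \in edge_lists -> f @: [set: 'I_m] \in graphs n m.
Proof.
move=> /edge_listsP[f_inj f2]; rewrite inE card_imset // cardsT card_ord eqxx andbT.
by apply/'forall_implyP => _ /imsetP[i _ ->]; rewrite f2.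
Qed.

Lemma card_edge_lists (B : pred {set {set 'I_n}}) :
  #|[set f in edge_lists | B (f @: [set: 'I_m])]| =
  #|[set E in graphs n m | B E]| * m`!.
Proof.
rewrite -sum1dep_card.
rewrite (partition_big (fun f : {ffun _ -> _} => f @: [set: 'I_m])
  (mem [set E in graphs n m | B E])) /=; last first.
  by move=> f /andP[/edge_list_graph fG Bf]; rewrite inE fG.
rewrite -sum_nat_const; apply: eq_bigr => E; rewrite inE => /andP[EG BE].
rewrite -(card_edge_lists_of EG) -sum1dep_card; apply: eq_bigl => f.
by rewrite -andbA; case: eqP => [->|]; rewrite ?BE ?andbF.
Qed.

(** Each graph has m! edge numberings and 2^m orientations, hence that many distinct throws whose
    loads are its degree sequence. Only an inequality is claimed, as throws producing loops or
    repeated edges may also satisfy [B]. *)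
Lemma card_bad_graphs (B : pred {ffun 'I_n -> nat}) :
  #|[set E in graphs n m | B (degree_sequence E)]| * m`! * 2 ^ m <=
  #|[set b : {ffun 'I_(2 * m) -> 'I_n} | B (loads b)]|.
Proof.
rewrite -(card_edge_lists (fun E => B (degree_sequence E))).
have -> : 2 ^ m = #|[set: {ffun 'I_m -> bool}]|.
  by rewrite cardsT card_ffun card_bool card_ord.
rewrite -cardsX -(@card_in_imset _ _ (fun p => throw_of p.1 p.2)).
  apply: subset_leq_card; apply/fintype.subsetP => _ /imsetP[[f o] + ->] /=.
  rewrite finset.in_setX finset.in_setT andbT inE => /andP[/edge_listsP[f_inj f2]].
  by rewrite inE -(loads_throw_of o).
move=> [f o] [f' o'] /=; rewrite !finset.in_setX !finset.in_setT !andbT /=.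
rewrite finset.in_set [X in _ -> is_true X -> _]finset.in_set.
move=> /andP[/edge_listsP[_ f2] _] /andP[/edge_listsP[_ f2'] _].
exact: throw_of_inj.
Qed.

(** Both sides count [edge_lists]: by the underlying graph, and directly as sequences of distinct
    pairs. *)
Lemma card_graphs : #|graphs n m| * m`! = 'C(n, 2) ^_ m.
Proof.
have := card_edge_lists predT; rewrite /= => h.
have -> : graphs n m = [set E in graphs n m | true].
  by apply/setP => E; rewrite inE andbT.
rewrite -h.
have -> : [set f in edge_lists | true] = edge_lists by apply/setP => f; rewrite inE andbT.
by rewrite card_inj_ffuns_on card_ord -cardsE card_draws card_ord.
Qed.

End Orientations.

(** * Stirling bounds for the factorial *)

Section Stirling.
Local Open Scope ring_scope.
Variable R : realType.
Implicit Types t x : R.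

Lemma ge0_of_derive_ge0 (f f' : R -> R) :
  (forall t, 0 <= t -> is_derive t (1 : R) f (f' t)) ->
  (forall t, 0 <= t -> 0 <= f' t) -> f 0 = 0 ->
  forall t, 0 <= t -> 0 <= f t.
Proof.
move=> df f'0 f0 t t0; rewrite -f0.
apply: (@ger0_derive1_ndecr R f 0 t) => //.
- move=> s; rewrite in_itv /= => /andP[/ltW s0 _].
  by case: (df s s0).
- move=> s; rewrite in_itv /= => /andP[/ltW s0 _]; rewrite derive1E.
  by have ds := df s s0; rewrite derive_val f'0.
- apply: derivable_within_continuous => s; rewrite in_itv /= => /andP[s0 _].
  by case: (df s s0).
Qed.

Lemma is_derive_ln1D t : 0 <= t -> is_derive t (1 : R) (fun s => ln (1 + s)) (1 + t)^-1.
Proof.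
move=> t0; have t1 : 0 < 1 + t by lra.
have d1 : is_derive t (1 : R) (fun s => 1 + s) 1.
  by have := is_deriveD (is_derive_cst (1 : R) t 1) (is_derive_id t (1 : R)); rewrite add0r.
have := @is_derive1_comp R (@ln R) (fun s => 1 + s) t _ _ (is_derive1_ln t1) d1.
by rewrite mulr1.
Qed.

Lemma is_derive_invD (c t : R) : 0 < c + t ->
  is_derive t (1 : R) (fun s => (c + s)^-1) (- (c + t) ^- 2).
Proof.
move=> tc; have d1 : is_derive t (1 : R) (fun s => c + s) 1.
  by have := is_deriveD (is_derive_cst (c : R) t 1) (is_derive_id t (1 : R)); rewrite add0r.
have := @is_deriveV R (fun s => c + s) t 1 1 _ d1; rewrite scaler1; apply.
by rewrite gt_eqF.
Qed.

(** Midpoint rule for the integral of the convex function 1/(1+s) over [0, t]. The difference of the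
    two sides vanishes at 0 and has derivative t^2 / ((1+t)(2+t)^2). *)
Lemma ln1D_ge t : 0 <= t -> 2 * t / (2 + t) <= ln (1 + t).
Proof.
pose g : R -> R := (fun s => ln (1 + s)) + cst (- 2) + 4 \*: (fun s => (2 + s)^-1).
suff H : forall s, 0 <= s -> 0 <= g s.
  move=> t0; have := H t t0.
  have -> : g t = ln (1 + t) + - 2 + 4 * (2 + t)^-1 by [].
  have -> : 2 * t / (2 + t) = 2 - 4 * (2 + t)^-1 by field; rewrite ?gt_eqF //; lra.
  lra.
apply: (@ge0_of_derive_ge0 _ (fun s => (1 + s)^-1 + 0 + 4 * (- (2 + s) ^- 2))).
- move=> s s0; apply: is_deriveD; last first.
    by apply: is_deriveZ; apply: is_derive_invD; lra.
  by apply: is_deriveD; apply: is_derive_ln1D.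
- move=> s s0; have -> : (1 + s)^-1 + 0 + 4 * (- (2 + s) ^- 2) = s ^+ 2 / ((1 + s) * (2 + s) ^+ 2).
    by field; rewrite !gt_eqF //; lra.
  by rewrite divr_ge0 ?sqr_ge0 // mulr_ge0 ?sqr_ge0 //; lra.
- have -> : g 0 = ln (1 + 0) + - 2 + 4 * (2 + 0)^-1 by [].
  by rewrite !addr0 ln1; field.
Qed.

(** Trapezoid rule for the same integral, an overestimate by convexity; the difference has
    derivative t^2 / (2(1+t)^2). *)
Lemma ln1D_le t : 0 <= t -> ln (1 + t) <= (t + t / (1 + t)) / 2.
Proof.
pose g : R -> R := 2^-1 \*: id - 2^-1 \*: (fun s => (1 + s)^-1) - (fun s => ln (1 + s)) + cst 2^-1.
suff H : forall s, 0 <= s -> 0 <= g s.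
  move=> t0; have := H t t0.
  have -> : g t = 2^-1 * t - 2^-1 * (1 + t)^-1 - ln (1 + t) + 2^-1 by [].
  have -> : (t + t / (1 + t)) / 2 = 2^-1 * t - 2^-1 * (1 + t)^-1 + 2^-1.
    by field; rewrite ?gt_eqF //; lra.
  lra.
apply: (@ge0_of_derive_ge0 _ (fun s => 2^-1 * 1 - 2^-1 * (- (1 + s) ^- 2) - (1 + s)^-1 + 0)).
- move=> s s0; apply: is_deriveD; apply: is_deriveB; last exact: is_derive_ln1D.
  by apply: is_deriveB; apply: is_deriveZ; apply: is_derive_invD; lra.
- move=> s s0; have -> : 2^-1 * 1 - 2^-1 * (- (1 + s) ^- 2) - (1 + s)^-1 + 0 =
      s ^+ 2 / (2 * (1 + s) ^+ 2).
    by field; rewrite !gt_eqF //; lra.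
  by rewrite divr_ge0 ?sqr_ge0 // mulr_ge0 ?sqr_ge0 //; lra.
- have -> : g 0 = 2^-1 * 0 - 2^-1 * (1 + 0)^-1 - ln (1 + 0) + 2^-1 by [].
  by rewrite !addr0 ln1; field.
Qed.

Lemma lnS_natr (x : nat) : (0 < x)%N -> ln x.+1%:R = ln x%:R + ln (1 + x%:R^-1) :> R.
Proof.
move=> x0; have xR : 0 < x%:R :> R by rewrite ltr0n.
rewrite -lnM ?posrE ?addr_gt0 ?invr_gt0 //; congr ln.
by rewrite -natr1; field; rewrite gt_eqF.
Qed.

(** Induction from x = 1, where equality holds; the step needs (x + 1/2) ln(1 + 1/x) >= 1, which is
    [ln1D_ge] at 1/x. *)
Lemma ln_fact_ub (x : nat) : (0 < x)%N ->
  ln x`!%:R <= (x%:R + 1 / 2) * ln x%:R - x%:R + 1 :> R.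
Proof.
elim: x => // -[_ _|x IH _]; first by rewrite (_ : 1`! = 1%N) // ln1; lra.
have xR : 0 < x.+1%:R :> R by rewrite ltr0n.
rewrite factS natrM lnM ?posrE ?ltr0n ?fact_gt0 // lnS_natr //.
have := IH isT; rewrite -[x.+2%:R]natr1; set X := x.+1%:R in xR * => hF.
have V0 : 0 < X^-1 by rewrite invr_gt0.
have := ln1D_ge (ltW V0); set u := ln (1 + _).
have -> : 2 * X^-1 / (2 + X^-1) = (X + 1 / 2)^-1.
  by field; rewrite !gt_eqF //; lra.
move=> hu; have : 1 <= (X + 1 / 2) * u.
  have X0 : 0 < X + 1 / 2 by lra.
  by rewrite -[leLHS](divff (lt0r_neq0 X0)) ler_pM2l.
lra.
Qed.

Lemma ln_fact_lb (x : nat) : (0 < x)%N ->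
  (x%:R + 1 / 2) * ln x%:R - x%:R <= ln x`!%:R :> R.
Proof.
(* The trapezoid bound leaves an error 1/(4x) - 1/(4(x+1)) at each step. The extra term 1/(4x) makes
   these errors telescope, and 3/4 gives equality at x = 1. *)
move=> x0; suff : (x%:R + 1 / 2) * ln x%:R - x%:R + 3 / 4 + (4 * x%:R)^-1 <= ln x`!%:R :> R.
  by have : 0 < (4 * x%:R)^-1 :> R; [rewrite invr_gt0 mulr_gt0 ?ltr0n|lra].
elim: x x0 => // -[_ _|x IH _]; first by rewrite (_ : 1`! = 1%N) // ln1; lra.
have xR : 0 < x.+1%:R :> R by rewrite ltr0n.
rewrite factS natrM lnM ?posrE ?ltr0n ?fact_gt0 // lnS_natr //.
have := IH isT; rewrite -[x.+2%:R]natr1; set X := x.+1%:R in xR * => hF.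
have V0 : 0 < X^-1 by rewrite invr_gt0.
have := ln1D_le (ltW V0); set u := ln (1 + _).
move=> hu; have : (X + 1 / 2) * u <= 1 + (4 * X)^-1 - (4 * (X + 1))^-1.
  have -> : 1 + (4 * X)^-1 - (4 * (X + 1))^-1 = (X + 1 / 2) * ((X^-1 + X^-1 / (1 + X^-1)) / 2).
    by field; rewrite !gt_eqF //; lra.
  by rewrite ler_pM2l //; lra.
move: hF; set a := (4 * X)^-1; set b := (4 * (X + 1))^-1 => hF h; lra.
Qed.

End Stirling.

(** * Growth of [nu], and size of [nu_fun] away from its zero *)

Section NuEstimates.
Local Open Scope ring_scope.
Variable R : realType.
Implicit Types x y K delta eps : R.

(** Quantitative form of [nu_fun_cross]: the term (y - x) ln n of the decomposition is kept, so
    f(x)/x falls by at least (y - x) ln n / (xy) between x and y. *)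
Lemma nu_fun_cross_ge (n k : nat) x y : (0 < n)%N -> 0 < x -> x < y ->
  (y - x) * ln n%:R <= y * nu_fun n k x - x * nu_fun n k y.
Proof.
move=> n_gt0 x0 xy; have y0 : 0 < y by apply: lt_trans xy.
have lnx : ln x <= x - 1.
  by have := @le_ln1Dx R (x - 1); rewrite subrKC; apply; lra.
have t_ge : y - x <= y * (ln y - ln x).
  have xy0 : 0 < x / y by rewrite divr_gt0.
  have := @le_ln1Dx R (x / y - 1); rewrite subrKC ln_div ?posrE// => H.
  have {H} : ln x - ln y <= x / y - 1 by apply: H; lra.
  rewrite -(ler_pM2l y0) mulrBr mulrBr mulr1 mulrCA divff ?gt_eqF//.
  by rewrite mulr1; lra.
have lnxy : ln x < ln y by rewrite ltr_ln ?posrE.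
rewrite /nu_fun.
set lx := ln x in lnx t_ge lnxy *; set ly := ln y in t_ge lnxy *.
set N := ln n%:R; set L := ln k%:R.
(* The terms before the last are nonnegative: the first and third by ln t <= t - 1 at x/y and at x,
   the second by monotonicity of ln, the fourth by its sign. *)
have -> : y * (x * L + x - (x + 1 / 2) * lx - (x - 1) * N) -
   x * (y * L + y - (y + 1 / 2) * ly - (y - 1) * N) =
   x * (y * (ly - lx) - (y - x)) + x * (ly - lx) / 2
   + (y - x) * (x - 1 - lx) / 2 + (y - x) * (x + 1) / 2 + (y - x) * N.
  by field.
have h1 : 0 <= x * (y * (ly - lx) - (y - x)).
  by rewrite mulr_ge0 ?subr_ge0 // ltW.
have h2 : 0 < x * (ly - lx) by rewrite mulr_gt0 ?subr_gt0.
have h3 : 0 <= (y - x) * (x - 1 - lx) by rewrite mulr_ge0 ?subr_ge0 // ltW.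
have h4 : 0 < (y - x) * (x + 1) by rewrite mulr_gt0 ?subr_gt0 ?addr_gt0.
lra.
Qed.

(* In the range k = O(n), nu n k is at most of order ln n / ln (ln n). *)
Lemma nu_le_ln (n k : nat) K delta : (0 < n)%N -> (0 < k)%N ->
  k%:R <= K * n%:R -> 1 <= K -> 0 < delta ->
  expR (ln K + 1 + delta^-1) <= delta * ln n%:R -> nu R n k <= delta * ln n%:R.
Proof.
move=> n0 k0 kK K1 d0 hy; set y := delta * ln n%:R in hy *.
have [nu0 fnu _] := nuP R n0 k0.
have nR : 0 < n%:R :> R by rewrite ltr0n.
have kR : 0 < k%:R :> R by rewrite ltr0n.
have K0 : 0 < K by lra.
have y0 : 0 < y by apply: lt_le_trans hy; exact: expR_gt0.
have lnn : ln n%:R = y / delta by rewrite /y mulrC mulKf ?gt_eqF.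
have lny : ln K + 1 + delta^-1 <= ln y.
  by rewrite -[leLHS]expRK ler_ln ?posrE ?expR_gt0.
have lnK0 : 0 <= ln K by exact: ln_ge0.
have dV : 0 < delta^-1 by rewrite invr_gt0.
have lnk : ln k%:R <= ln K + ln n%:R.
  by rewrite -lnM ?posrE // ler_ln ?posrE ?mulr_gt0.
(* If nu exceeded y, then f(y) would be positive. But in f(y) the ln n terms leave a single ln n = y
   / delta, and y ln y >= y (ln K + 1 + 1/delta) outweighs all the positive terms. *)
rewrite leNgt; apply/negP => lt_y.
have := nu_fun_cross k n0 y0 lt_y; rewrite fnu mulr0.
rewrite pmulr_rgt0 // => fy; suff : nu_fun n k y <= 0 by lra.
rewrite /nu_fun; set ly := ln y in lny *; set lk := ln k%:R in lnk *.
have h1 : y * lk <= y * (ln K + ln n%:R) by rewrite ler_pM2l.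
have h2 : y * (ln K + 1 + delta^-1) <= y * ly by rewrite ler_pM2l.
move: h1; rewrite lnn; move: h2.
have -> : y * (ln K + 1 + delta^-1) = y * ln K + y + y / delta by field; rewrite gt_eqF.
lra.
Qed.

(** The cross inequality between the zero nu and y gives eps ln n <= - nu f(y), and nu <= delta ln n
    turns this into eps / delta. The next lemma is the mirror case, with nu as right endpoint. *)
Lemma nu_fun_gt_nu (n k : nat) delta eps y : (0 < n)%N -> (0 < k)%N ->
  0 < delta -> nu R n k <= delta * ln n%:R -> 0 < eps -> nu R n k + eps <= y ->
  nu_fun n k y <= - (eps / delta).
Proof.
move=> n0 k0 d0 hnu e0 hy; have [nu0 fnu _] := nuP R n0 k0.
have := @nu_fun_cross_ge n k (nu R n k) y n0 nu0; rewrite fnu mulr0 sub0r => H.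
have {}H : (y - nu R n k) * ln n%:R <= - (nu R n k * nu_fun n k y) by apply: H; lra.
have lnn0 : 0 < ln n%:R :> R by rewrite -(pmulr_rgt0 _ d0); lra.
have h1 : eps * ln n%:R <= (y - nu R n k) * ln n%:R by rewrite ler_pM2r //; lra.
rewrite lerNr ler_pdivrMr // -(ler_pM2l nu0).
have h2 : nu R n k * eps <= delta * (eps * ln n%:R) by rewrite mulrCA mulrC ler_pM2l.
have h3 : delta * (eps * ln n%:R) <= delta * - (nu R n k * nu_fun n k y).
  by rewrite ler_pM2l //; lra.
lra.
Qed.

Lemma nu_fun_lt_nu (n k : nat) delta eps x : (0 < n)%N -> (0 < k)%N ->
  0 < delta -> nu R n k <= delta * ln n%:R -> 0 < eps -> 0 < x -> x <= nu R n k - eps ->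
  eps / delta <= nu_fun n k x.
Proof.
move=> n0 k0 d0 hnu e0 x0 hx; have [nu0 fnu _] := nuP R n0 k0.
have := @nu_fun_cross_ge n k x (nu R n k) n0 x0; rewrite fnu mulr0 subr0 => H.
have {}H : (nu R n k - x) * ln n%:R <= nu R n k * nu_fun n k x by apply: H; lra.
have lnn0 : 0 < ln n%:R :> R by rewrite -(pmulr_rgt0 _ d0); lra.
have h1 : eps * ln n%:R <= (nu R n k - x) * ln n%:R by rewrite ler_pM2r //; lra.
rewrite ler_pdivrMr // -(ler_pM2l nu0).
have h2 : nu R n k * eps <= delta * (eps * ln n%:R) by rewrite mulrCA mulrC ler_pM2l.
have h3 : delta * (eps * ln n%:R) <= delta * (nu R n k * nu_fun n k x).
  by rewrite ler_pM2l //; lra.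
lra.
Qed.

(* Up to the bounded factor exp (- k / n), the Poisson mean of the number of bins
   of load x. *)
Definition poisson_bins (n k x : nat) : R :=
  n%:R * (k%:R / n%:R) ^+ x / x`!%:R.

Lemma ln_poisson_bins (n k x : nat) : (0 < n)%N -> (0 < k)%N ->
  0 < poisson_bins n k x /\
  ln (poisson_bins n k x) = ln n%:R + x%:R * (ln k%:R - ln n%:R) - ln x`!%:R.
Proof.
move=> n0 k0; have nR : 0 < n%:R :> R by rewrite ltr0n.
have kR : 0 < k%:R :> R by rewrite ltr0n.
have fR : 0 < x`!%:R :> R by rewrite ltr0n fact_gt0.
have pR : 0 < (k%:R / n%:R) ^+ x :> R by rewrite exprn_gt0 ?divr_gt0.
split; first by rewrite divr_gt0 ?mulr_gt0.
rewrite ln_div ?posrE ?mulr_gt0 // lnM ?posrE // lnXn ?divr_gt0 //.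
by rewrite ln_div ?posrE // mulr_natl.
Qed.

Lemma poisson_bins_ub (n k x : nat) : (0 < n)%N -> (0 < k)%N -> (0 < x)%N ->
  poisson_bins n k x <= expR (nu_fun n k x%:R).
Proof.
move=> n0 k0 x0; have [q0 lnq] := ln_poisson_bins x n0 k0.
rewrite -[leLHS](lnK q0) ler_expR lnq /nu_fun.
by have := @ln_fact_lb R x x0; lra.
Qed.

Lemma poisson_bins_lb (n k x : nat) : (0 < n)%N -> (0 < k)%N -> (0 < x)%N ->
  expR (nu_fun n k x%:R - 1) <= poisson_bins n k x.
Proof.
move=> n0 k0 x0; have [q0 lnq] := ln_poisson_bins x n0 k0.
rewrite -[leRHS](lnK q0) ler_expR lnq /nu_fun.
by have := @ln_fact_ub R x x0; lra.
Qed.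

End NuEstimates.

(** * Uniform probability on a finite set *)

Section UniformProbability.
Local Open Scope ring_scope.
Variables (R : realType) (T : finType) (Omega : {set T}).
Implicit Types A B C : pred T.

Lemma unif_prob_ge0 A : 0 <= unif_prob R Omega A.
Proof. by rewrite divr_ge0. Qed.

Lemma unif_prob_sub A B : {in Omega, forall x, A x -> B x} ->
  unif_prob R Omega A <= unif_prob R Omega B.
Proof.
move=> AB; rewrite ler_wpM2r ?invr_ge0 // ler_nat; apply/subset_leq_card.
by apply/fintype.subsetP => x; rewrite !inE => /andP[xO /(AB _ xO) ->]; rewrite xO.
Qed.

Lemma unif_prob_subU A B C : {in Omega, forall x, A x -> B x || C x} ->
  unif_prob R Omega A <= unif_prob R Omega B + unif_prob R Omega C.
Proof.
move=> ABC; rewrite -mulrDl ler_wpM2r ?invr_ge0 // -natrD ler_nat.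
rewrite -cardUI; apply: leq_trans (leq_addr _ _); apply/subset_leq_card.
apply/fintype.subsetP => x; rewrite !inE => /andP[xO /(ABC _ xO)].
by rewrite xO.
Qed.

Lemma unif_probC A : (0 < #|Omega|)%N ->
  unif_prob R Omega A = 1 - unif_prob R Omega (fun x => ~~ A x).
Proof.
move=> O0; have OR : #|Omega|%:R != 0 :> R by rewrite pnatr_eq0 -lt0n.
apply/eqP; rewrite eq_sym subr_eq -mulrDl -natrD; apply/eqP.
rewrite -[LHS](divff OR); congr (_%:R / _).
rewrite -(cardID A Omega); congr (_ + _)%N; apply: eq_card => x; rewrite !inE //.
by rewrite andbC.
Qed.

End UniformProbability.

(** * Second-moment inequality and upper tail of the loads *)

Section SecondMoment.
Local Open Scope ring_scope.
Variable R : realType.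

(** Each zero of [X] contributes mu^2 to the sum of (X t - mu)^2, where mu is the mean; the
    right-hand side is the variance divided by mu^2. *)
Lemma chebyshev_zero (T : finType) (X : T -> R) : (0 < #|T|)%N -> \sum_t X t != 0 ->
  #|[set t | X t == 0]%SET|%:R / #|T|%:R <=
  #|T|%:R * (\sum_t X t ^+ 2) / (\sum_t X t) ^+ 2 - 1.
Proof.
move=> T0 S0; set S := \sum_t X t in S0 *; set Q := \sum_t _.
have TR : 0 < #|T|%:R :> R by rewrite ltr0n.
pose mu := S / #|T|%:R.
have mu_neq0 : mu != 0 by rewrite mulf_neq0 // invr_neq0 // gt_eqF.
have mu0 : 0 < mu ^+ 2 by rewrite exprn_even_gt0.
have H : #|[set t | X t == 0]%SET|%:R * mu ^+ 2 <= Q - mu ^+ 2 * #|T|%:R.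
  have -> : Q - mu ^+ 2 * #|T|%:R = \sum_t (X t - mu) ^+ 2.
    rewrite (eq_bigr (fun t => X t ^+ 2 - 2 * mu * X t + mu ^+ 2)); last by move=> t _; ring.
    rewrite !big_split /= sumrN -mulr_sumr -/S -/Q sumr_const -[_ *+ _]mulr_natr.
    by rewrite /mu; field; rewrite gt_eqF.
  rewrite [leRHS](bigID (fun t => X t == 0)) /= -[leLHS]addr0 lerD //.
    rewrite (eq_bigr (fun=> mu ^+ 2)) => [|t /eqP ->]; last by rewrite sub0r sqrrN.
    by rewrite sumr_const cardsE mulr_natl.
  by apply: sumr_ge0 => t _; rewrite sqr_ge0.
rewrite ler_pdivrMr //; move: H; rewrite -ler_pdivlMr //.
have -> : (Q - mu ^+ 2 * #|T|%:R) / mu ^+ 2 = (#|T|%:R * Q / S ^+ 2 - 1) * #|T|%:R.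
  by rewrite /mu; field; rewrite S0 gt_eqF.
by [].
Qed.

Lemma one_sub_ge_expR (t : R) : 0 <= t <= 1 / 2 -> expR (- (2 * t)) <= 1 - t.
Proof.
move=> /andP[t0 t1]; rewrite expRN -[leLHS]mul1r ler_pdivrMr ?expR_gt0 //.
have := @expR_ge1Dx R (2 * t) => h.
(* (1 - t)(1 + 2t) = 1 + t(1 - 2t) >= 1 on [0, 1/2]. *)
apply: (@le_trans _ _ ((1 - t) * (1 + 2 * t))); first by nra.
by rewrite ler_pM2l //; lra.
Qed.

Lemma bernoulli_le (t : R) (m : nat) : 0 <= t <= 1 -> 1 - m%:R * t <= (1 - t) ^+ m.
Proof.
move=> /andP[t0 t1]; elim: m => [|m IH]; first by rewrite mul0r subr0 expr0.
rewrite exprS -natr1; apply: (@le_trans _ _ ((1 - t) * (1 - m%:R * t))).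
  by have : 0 <= m%:R :> R by []; nra.
by rewrite ler_wpM2l //; lra.
Qed.

Lemma leq_ffact_exp (k x : nat) : (k ^_ x <= k ^ x)%N.
Proof.
rewrite ffact_prod -[X in (_ <= _ ^ X)%N](card_ord x) -prod_nat_const.
by apply: leq_prod => i _; exact: leq_subr.
Qed.

Lemma leq_exp_ffact (k x : nat) : ((k - x) ^ x <= k ^_ x)%N.
Proof.
rewrite ffact_prod -[X in (_ ^ X <= _)%N](card_ord x) -prod_nat_const.
by apply: leq_prod => i _; exact/leq_sub2l/ltnW.
Qed.

Lemma card_throws k n : #|throws k n| = (n ^ k)%N.
Proof. by rewrite cardsT card_ffun !card_ord. Qed.

Lemma unif_prob_throws k n (A : pred {ffun 'I_k -> 'I_n}) :
  unif_prob R (throws k n) A = #|[set b | A b]%SET|%:R / (n ^ k)%:R.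
Proof.
rewrite /unif_prob card_throws; congr (_%:R / _); rewrite cardsE.
by apply: eq_card => b; rewrite !inE.
Qed.

(** The union bound of [card_load_ge] with C(k, x) <= k^x / x!. The case k < x is separate: there
    the event is empty and [k - x] truncates. *)
Lemma prob_load_ge n k x : (0 < n)%N -> (0 < k)%N ->
  unif_prob R (throws k n) (fun b => [exists j, (x <= loads b j)%N]) <=
  poisson_bins R n k x.
Proof.
move=> n0 k0; have nR : 0 < n%:R :> R by rewrite ltr0n.
have q0 := (ln_poisson_bins R x n0 k0).1.
have [kx|xk] := ltnP k x; rewrite unif_prob_throws.
  rewrite (_ : [set b | _]%SET = finset.set0) ?cards0 ?mul0r ?(ltW q0) //.
  apply/setP => b; rewrite !inE; apply/negbTE/existsPn => j.
  rewrite -ltnNge loadsE (leq_ltn_trans _ kx) //.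
  by rewrite -[leqRHS](card_ord k) max_card.
have h : (#|[set b : {ffun 'I_k -> 'I_n} | [exists j, (x <= loads b j)%N]]%SET| <=
    n * ('C(k, x) * n ^ (k - x)))%N.
  apply: leq_trans (card_load_ge k n x); apply/eq_leq/eq_card => b; rewrite !inE.
  by apply: eq_existsb => j; rewrite loadsE.
rewrite ler_pdivrMr ?ltr0n ?expn_gt0 ?n0 //; move: h; rewrite -(ler_nat R).
move=> /le_trans; apply; rewrite !natrM /poisson_bins -mulrA -mulrA ler_pM2l //.
have fR : 0 < x`!%:R :> R by rewrite ltr0n fact_gt0.
have : ('C(k, x) * x`!)%:R <= (k ^ x)%:R :> R by rewrite bin_ffact ler_nat leq_ffact_exp.
rewrite natrM -ler_pdivlMr // => h.
have -> : (n ^ k)%:R = n%:R ^+ (k - x) * n%:R ^+ x :> R.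
  by rewrite natrX -exprD subnK.
rewrite !natrX expr_div_n in h *.
have -> : k%:R ^+ x / n%:R ^+ x / x`!%:R * (n%:R ^+ (k - x) * n%:R ^+ x) =
   k%:R ^+ x / x`!%:R * n%:R ^+ (k - x) :> R.
  by field; rewrite expf_neq0 ?(lt0r_neq0 nR) ?(lt0r_neq0 fR).
by rewrite ler_wpM2r // exprn_ge0 ?(ltW nR).
Qed.

End SecondMoment.

(** * Lower tail: moments of the number of bins of load exactly [x] *)

Section LowerTail.
Local Open Scope ring_scope.
Variable R : realType.

Definition bins_of_load k n x (b : {ffun 'I_k -> 'I_n}) : nat :=
  (\sum_j (#|balls_in b j| == x))%N.

Lemma sum_bins_of_load k n x :
  (\sum_(b : {ffun 'I_k -> 'I_n}) bins_of_load x b = n * ('C(k, x) * n.-1 ^ (k - x)))%N.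
Proof.
rewrite exchange_big /= (eq_bigr (fun=> ('C(k, x) * n.-1 ^ (k - x))%N)) => [|j _].
  by rewrite sum_nat_const card_ord.
rewrite -(card_load_eq k x j) -sum1dep_card [RHS]big_mkcond.
by apply: eq_bigr => b _; case: eqP.
Qed.

(** Expand the square over ordered pairs of bins: the diagonal is the first moment, and the n(n-1)
    off-diagonal pairs are counted as n^2. *)
Lemma sum_sqr_bins_of_load k n x :
  (\sum_(b : {ffun 'I_k -> 'I_n}) bins_of_load x b ^ 2 <=
   n * ('C(k, x) * n.-1 ^ (k - x)) +
   n * (n * ('C(k, x) * ('C(k - x, x) * (n - 2) ^ (k - x - x)))))%N.
Proof.
set A := ('C(k, x) * n.-1 ^ (k - x))%N; set B := ('C(k, x) * _)%N.
pose c (j l : 'I_n) := #|[set b : {ffun 'I_k -> 'I_n} |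
  (#|balls_in b j| == x) && (#|balls_in b l| == x)]%SET|.
have -> : (\sum_(b : {ffun 'I_k -> 'I_n}) bins_of_load x b ^ 2 =
    \sum_j \sum_l c j l)%N.
  rewrite (eq_bigr (fun b : {ffun 'I_k -> 'I_n} =>
    \sum_j \sum_l ((#|balls_in b j| == x) * (#|balls_in b l| == x))%N)%N); last first.
    by move=> b _; rewrite -mulnn /bins_of_load big_distrlr.
  rewrite exchange_big /=; apply: eq_bigr => j _.
  rewrite exchange_big /=; apply: eq_bigr => l _.
  rewrite /c -sum1dep_card [RHS]big_mkcond.
  by apply: eq_bigr => b _; rewrite mulnb; case: (_ && _).
have -> : (n * A + n * (n * B) = \sum_(j < n) (A + n * B))%N.
  by rewrite sum_nat_const card_ord mulnDr.
apply: leq_sum => j _; rewrite (bigD1 j) //= leq_add //.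
  rewrite /c /A -(card_load_eq k x j); apply/eq_leq/eq_card => b.
  by rewrite !inE andbb.
rewrite (eq_bigr (fun=> B)) => [|l lj]; last by rewrite /c card_load_eq2 // eq_sym.
by rewrite sum_nat_const leq_mul2r -[leqRHS](card_ord n) max_card orbT.
Qed.

(** Chebyshev for [bins_of_load]: the diagonal of the second moment gives the reciprocal of the
    mean, and the off-diagonal pairs give the correlation factor (n/(n-1))^(2x). *)
Lemma prob_no_load_eq n k x : (1 < n)%N -> (x <= k)%N ->
  unif_prob R (throws k n) (fun b => ~~ [exists j, loads b j == x]) <=
  (n ^ k)%:R / (n * ('C(k, x) * n.-1 ^ (k - x)))%:R
  + (n%:R / n.-1%:R) ^+ (2 * x) - 1.
Proof.
move=> n1 xk; have := @load_pair_correlation k n x n1.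
have := sum_sqr_bins_of_load k n x; have := sum_bins_of_load k n x.
set A := ('C(k, x) * n.-1 ^ (k - x))%N; set B := ('C(k, x) * _)%N => S1 S2 AB.
have n'0 : 0 < n.-1%:R :> R by rewrite ltr0n; lia.
have nR : 0 < n%:R :> R by rewrite ltr0n; lia.
have A0 : (0 < A)%N by rewrite muln_gt0 bin_gt0 xk expn_gt0; lia.
have AR : 0 < A%:R :> R by rewrite ltr0n.
pose X (b : {ffun 'I_k -> 'I_n}) : R := (bins_of_load x b)%:R.
have cT : #|{ffun 'I_k -> 'I_n}| = (n ^ k)%N by rewrite card_ffun !card_ord.
have SX : \sum_b X b = n%:R * A%:R by rewrite -natr_sum S1 natrM.
have := @chebyshev_zero R _ X; rewrite SX cT.
rewrite expn_gt0 (ltnW n1) mulf_neq0 ?(lt0r_neq0 nR) ?(lt0r_neq0 AR) //= => /(_ isT isT) H.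
rewrite unif_prob_throws; apply: le_trans (le_trans H _).
  rewrite ler_wpM2r ?invr_ge0 // ler_nat; apply/eq_leq/eq_card => b.
  rewrite !inE /X pnatr_eq0 /bins_of_load sum_nat_eq0 negb_exists.
  by apply: eq_forallb => j; rewrite loadsE; case: eqP.
rewrite lerD2r.
have Q : \sum_b X b ^+ 2 <= n%:R * A%:R + n%:R * (n%:R * B%:R).
  rewrite -!natrM -natrD; apply: le_trans (_ : _ <= _%:R) _; last by rewrite ler_nat; exact: S2.
  by rewrite natr_sum; apply: ler_sum => b _; rewrite natrX.
have nk0 : 0 < (n ^ k)%:R :> R by rewrite ltr0n expn_gt0 (ltnW n1).
apply: (@le_trans _ _ ((n ^ k)%:R * (n%:R * A%:R + n%:R * (n%:R * B%:R)) / (n%:R * A%:R) ^+ 2)).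
  by rewrite ler_pM2r ?invr_gt0 ?exprn_gt0 ?mulr_gt0 // ler_pM2l.
have -> : (n ^ k)%:R * (n%:R * A%:R + n%:R * (n%:R * B%:R)) / (n%:R * A%:R) ^+ 2 =
    (n ^ k)%:R / (n * A)%:R + B%:R * (n ^ k)%:R / A%:R ^+ 2 :> R.
  by rewrite natrM; field; rewrite !gt_eqF.
rewrite lerD2l expr_div_n ler_pdivrMr ?exprn_gt0 // mulrAC ler_pdivlMr ?exprn_gt0 //.
by rewrite -!natrX -!natrM ler_nat [X in (_ <= X)%N]mulnC.
Qed.

(** Two losses against [poisson_bins]: C(k, x) >= k^x / (2 x!), because (1 - x/k)^x >= 1 - x^2/k >=
    1/2, and (1 - 1/n)^(k-x) >= exp(-2k/n) >= exp(-2K). *)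
Lemma mean_bins_of_load_lb n k x (K : R) : (1 < n)%N -> (0 < k)%N ->
  k%:R <= K * n%:R -> (2 * x ^ 2 <= k)%N ->
  poisson_bins R n k x / (2 * expR (2 * K)) <=
  (n * ('C(k, x) * n.-1 ^ (k - x)))%:R / (n ^ k)%:R.
Proof.
move=> n1 k0 kK xk2; have xk : (x <= k)%N by nia.
have nR : 0 < n%:R :> R by rewrite ltr0n; lia.
have kR : 0 < k%:R :> R by rewrite ltr0n.
have fR : 0 < x`!%:R :> R by rewrite ltr0n fact_gt0.
have hC : k%:R ^+ x / 2 / x`!%:R <= 'C(k, x)%:R :> R.
  rewrite ler_pdivrMr // -natrM bin_ffact.
  apply: (@le_trans _ _ ((k - x) ^ x)%:R); last by rewrite ler_nat leq_exp_ffact.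
  have -> : ((k - x) ^ x)%:R = k%:R ^+ x * (1 - x%:R / k%:R) ^+ x :> R.
    by rewrite natrX natrB // -exprMn; congr (_ ^+ _); field; rewrite gt_eqF.
  rewrite ler_pM2l ?exprn_gt0 //.
  apply: le_trans (bernoulli_le x (_ : 0 <= x%:R / k%:R <= 1)); last first.
    by rewrite divr_ge0 //= ler_pdivrMr // mul1r ler_nat.
  have : x%:R * (x%:R / k%:R) <= 1 / 2 :> R.
    rewrite mulrA ler_pdivrMr //; move: xk2; rewrite -(ler_nat R) natrM natrX expr2; lra.
  lra.
have hn : expR (- (2 * K)) <= (n.-1%:R / n%:R) ^+ (k - x) :> R.
  have -> : n.-1%:R / n%:R = 1 - n%:R^-1 :> R.
    by rewrite -subn1 natrB ?(ltnW n1) // mulrBl divff ?gt_eqF // div1r.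
  have nV : 0 < n%:R^-1 :> R by rewrite invr_gt0.
  have nV2 : n%:R^-1 <= 1 / 2 :> R.
    by rewrite -div1r ler_pdivrMr // ; move: n1; rewrite -(ler_nat R); lra.
  apply: (@le_trans _ _ ((1 - n%:R^-1) ^+ k)); last first.
    by apply: ler_wiXn2l; [lra|lra|exact: leq_subr].
  apply: (@le_trans _ _ (expR (- (2 * n%:R^-1)) ^+ k)); last first.
    by rewrite lerXn2r ?nnegrE ?expR_ge0 //; [lra|apply: one_sub_ge_expR; lra].
  rewrite -expRM_natl ler_expR mulrN lerN2 mulrCA ler_pM2l //.
  by rewrite ler_pdivrMr.
have -> : (n * ('C(k, x) * n.-1 ^ (k - x)))%:R / (n ^ k)%:R =
  n%:R * ('C(k, x)%:R / n%:R ^+ x * (n.-1%:R / n%:R) ^+ (k - x)) :> R.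
  rewrite !natrM !natrX -[in X in _ / _ ^+ X](subnK xk) exprD expr_div_n.
  by field; rewrite !expf_neq0 ?(lt0r_neq0 nR).
have -> : poisson_bins R n k x / (2 * expR (2 * K)) =
  n%:R * (k%:R ^+ x / 2 / x`!%:R / n%:R ^+ x * expR (- (2 * K))).
  rewrite /poisson_bins expRN expr_div_n.
  by field; rewrite expf_neq0 ?(lt0r_neq0 nR) ?(lt0r_neq0 fR) ?(lt0r_neq0 (expR_gt0 _)).
rewrite ler_pM2l // ler_pM //.
by rewrite ler_pM2r // invr_gt0 exprn_gt0.
Qed.

End LowerTail.

(** * Concentration of the maximum load *)

Section MaxLoad.
Local Open Scope ring_scope.
Variable R : realType.

Lemma expRN_le_inv (t : R) : 0 < t -> expR (- t) <= t^-1.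
Proof.
move=> t0; rewrite expRN lef_pV2 ?posrE ?expR_gt0 //.
by have := @expR_ge1Dx R t; lra.
Qed.

(** The term t^5 / 5! of the exponential series suffices, since 480 is 4 times 5!. *)
Lemma expR_ge_pow4 (t : R) : 480 <= t -> 4 * t ^+ 4 <= expR t.
Proof.
move=> t480; have t0 : 0 <= t by lra.
have := @expR_ge1Dxn R t 4 t0; rewrite (_ : 5`! = 120)%N //.
have : 480 * t ^+ 4 <= t ^+ 5 by rewrite [t ^+ 5]exprS ler_wpM2r // exprn_ge0.
lra.
Qed.

(* A bin of load [x >= 2] can only be expected when there are at least about
   [sqrt n] balls. *)
Lemma sqr_balls_ge n k x : (0 < n)%N -> (0 < k)%N -> (1 < x)%N ->
  1 <= poisson_bins R n k x -> (n <= k ^ 2)%N.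
Proof.
move=> n0 k0 x1 q1; have nR : 0 < n%:R :> R by rewrite ltr0n.
have fR : 1 <= x`!%:R :> R by rewrite ler1n fact_gt0.
have h : (n ^ x <= n * k ^ x)%N.
  rewrite -(ler_nat R) natrM !natrX; move: q1.
  rewrite /poisson_bins ler_pdivlMr ?mul1r; last by lra.
  rewrite expr_div_n mulrA ler_pdivlMr ?exprn_gt0 //; apply: le_trans.
  by rewrite ler_peMl // exprn_ge0 ?ltW.
have {}h : (n ^ x.-1 <= k ^ x)%N.
  by rewrite -(leq_pmul2l n0) -expnS prednK //; lia.
(* Otherwise k^x <= k^(2(x-1)) < n^(x-1), the first inequality using x >= 2. *)
rewrite leqNgt; apply/negP => lt_kn.
have : (k ^ x <= (k ^ 2) ^ x.-1)%N by rewrite -expnM leq_pexp2l //; lia.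
have : ((k ^ 2) ^ x.-1 < n ^ x.-1)%N by rewrite ltn_exp2r //; lia.
lia.
Qed.

(** The hypotheses give nu <= delta ln n. One delta / eps bounds the upper tail, its other multiple
    the reciprocal mean in the lower tail, and 4 delta the correlation between bins. *)
Lemma max_load_concentration n k (K eps delta : R) :
  (1 < n)%N -> (0 < k)%N -> k%:R <= K * n%:R -> 1 <= K ->
  0 < eps -> 0 < delta -> 4 * delta <= 1 -> delta <= eps ->
  expR (ln K + 1 + delta^-1) <= delta * ln n%:R -> 480 <= ln (n%:R : R) ->
  unif_prob R (throws k n) (fun b =>
    ~~ (Num.floor (nu R n k - eps) <= (\max_j loads b j)%N%:Z
          <= Num.floor (nu R n k + eps))) <=
  (1 + 2 * expR (2 * K + 1)) * (delta / eps) + 4 * delta.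
Proof.
move=> n1 k0 kK K1 e0 d0 d1 de hK ln480; have n0 := ltnW n1.
have hnu := nu_le_ln n0 k0 kK K1 d0 hK.
have [nu0 _ _] := nuP R n0 k0; set v := nu R n k in hnu nu0 *.
have nR : 0 < n%:R :> R by rewrite ltr0n.
have de0 : 0 < delta / eps by rewrite divr_gt0.
have ed0 : 0 < eps / delta by rewrite divr_gt0.
have edV : (eps / delta)^-1 = delta / eps by rewrite invf_div.
have exp_de : expR (- (eps / delta)) <= delta / eps by rewrite -edV expRN_le_inv.
(* The least integer above nu + eps: the upper bound fails only if some load reaches it. *)
pose x1 := (Num.truncn (v + eps)).+1.
have P1 : unif_prob R (throws k n) (fun b => [exists j, (x1 <= loads b j)%N]) <= delta / eps.
  apply: le_trans (@prob_load_ge R n k x1 n0 k0) _.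
  apply: le_trans (poisson_bins_ub R n0 k0 (ltn0Sn _)) _; apply: le_trans exp_de.
  rewrite ler_expR; apply: nu_fun_gt_nu => //; rewrite -/v ltW //.
  exact: truncnS_gt.
have upper (b : {ffun 'I_k -> 'I_n}) : ~~ [exists j, (x1 <= loads b j)%N] ->
    (\max_j loads b j)%N%:Z <= Num.floor (v + eps).
  move=> /existsPn small; rewrite floor_ge_int.
  apply: (@le_trans _ _ (Num.truncn (v + eps))%:R); last by rewrite truncn_le; lra.
  by rewrite ler_nat; apply/bigmax_leqP => j _; rewrite -ltnS ltnNge small.
have C0 : 0 < 2 * expR (2 * K + 1) * (delta / eps).
  by rewrite mulr_gt0 // mulr_gt0 ?expR_gt0.
have lower (b : {ffun 'I_k -> 'I_n}) (x : nat) : v - eps < x.+1%:R ->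
    (exists j, (x <= loads b j)%N) -> Num.floor (v - eps) <= (\max_j loads b j)%N%:Z.
  move=> vx [j xj]; rewrite -ltzD1 floor_lt_int; apply: lt_le_trans vx _.
  rewrite -natr1 intrD lerD2r ler_nat.
  exact: (bigop.bigmax_sup j).
(* If nu - eps < 2, its floor is at most 1, and some bin is nonempty since k > 0: only the upper
   tail remains. *)
have [v2|v2] := ltP (v - eps) 2.
  apply: (@le_trans _ _ (delta / eps)); last by lra.
  apply: le_trans P1; apply: unif_prob_sub => b _; apply: contraR => /upper ->.
  rewrite andbT; apply: (lower b 1%N) => //; exists (b (Ordinal k0)).
  by rewrite loadsE; apply/card_gt0P; exists (Ordinal k0); rewrite inE.
pose x := Num.truncn (v - eps).
have x_le : x%:R <= v - eps by rewrite truncn_le; lra.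
have x2 : (2 <= x)%N by rewrite truncn_ge_nat //; lra.
have x0 := ltnW x2.
have xR : 0 < x%:R :> R by rewrite ltr0n.
have lnn : delta * ln n%:R <= ln n%:R by rewrite ler_piMl //; lra.
have q_ge : expR (eps / delta - 1) <= poisson_bins R n k x.
  apply: le_trans (poisson_bins_lb R n0 k0 x0).
  by rewrite ler_expR lerB // nu_fun_lt_nu.
have q1 : 1 <= poisson_bins R n k x.
  apply: le_trans q_ge; by rewrite -[leLHS]expR0 ler_expR subr_ge0 ler_pdivlMr // mul1r.
have kn : (n <= k ^ 2)%N by exact: sqr_balls_ge q1.
(* 4 x^4 <= 4 (ln n)^4 <= n <= k^2, then take square roots. *)
have xk2 : (2 * x ^ 2 <= k)%N.
  have : (4 * x ^ 4 <= n)%N.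
    rewrite -(ler_nat R) natrM natrX -[leRHS](lnK nR).
    apply: le_trans (expR_ge_pow4 ln480); rewrite ler_pM2l //.
    by rewrite lerXn2r ?nnegrE //; lra.
  move=> h; rewrite -(@leq_exp2r _ _ 2) //; apply: leq_trans kn.
  by rewrite expnMn -expnM.
have xk : (x <= k)%N by move: xk2; clear; nia.
have q0 : 0 < poisson_bins R n k x by lra.
have P2 : unif_prob R (throws k n) (fun b => ~~ [exists j, loads b j == x]) <=
    2 * expR (2 * K + 1) * (delta / eps) + 4 * delta.
  apply: le_trans (@prob_no_load_eq R n k x n1 xk) _; rewrite -addrA lerD //.
    (* The reciprocal mean is at most 2 exp(2K) / [poisson_bins], and [poisson_bins] is at least
       exp(eps / delta - 1). *)
    have := mean_bins_of_load_lb n1 k0 kK xk2; rewrite -[X in _ <= X -> _]invf_div.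
    set M := (n ^ k)%:R / _ => hM.
    have c0 : 0 < poisson_bins R n k x / (2 * expR (2 * K)).
      by rewrite divr_gt0 // mulr_gt0 ?expR_gt0.
    have M0 : 0 < M by rewrite -invr_gt0; apply: lt_le_trans hM.
    move: hM; rewrite -[leRHS]div1r ler_pdivlMr // mulrC -ler_pdivlMr // div1r invf_div.
    move=> /le_trans; apply; rewrite ler_pdivrMr //.
    apply: (@le_trans _ _ (2 * expR (2 * K + 1) * expR (- (eps / delta)) * expR (eps / delta - 1))).
      rewrite -!mulrA ler_pM2l // -!expRD ler_expR; lra.
    by apply: ler_pM => //; rewrite ?mulr_ge0 ?expR_ge0 // ler_pM2l // mulr_gt0 ?expR_gt0.
  rewrite lerBlDr -[_ / _]invf_div exprVn.
  (* Since x <= delta ln n <= delta n, Bernoulli gives (1 - 1/n)^(2x) >= 1 - 2 delta, whose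
     reciprocal is at most 1 + 4 delta when 4 delta <= 1. *)
  have xn : x%:R / n%:R <= delta.
    rewrite ler_pdivrMr //; apply: (@le_trans _ _ (delta * ln n%:R)); first by lra.
    by rewrite ler_pM2l // ltW // ln_sublinear.
  have : 1 - 2 * delta <= (n.-1%:R / n%:R) ^+ (2 * x).
    have -> : n.-1%:R / n%:R = 1 - n%:R^-1 :> R.
      by rewrite -subn1 natrB ?(ltnW n1) // mulrBl divff ?gt_eqF // div1r.
    apply: le_trans (bernoulli_le (2 * x) (_ : 0 <= n%:R^-1 <= 1)); last first.
      by rewrite invr_ge0 ler0n invf_le1 // ler1n.
    by rewrite natrM -mulrA; lra.
  set z := _ ^+ _ => hz; have z0 : 0 < z by lra.
  rewrite -div1r ler_pdivrMr //.
  apply: (@le_trans _ _ ((4 * delta + 1) * (1 - 2 * delta))); first by nra.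
  by rewrite ler_pM2l //; lra.
have -> : (1 + 2 * expR (2 * K + 1)) * (delta / eps) + 4 * delta =
   delta / eps + (2 * expR (2 * K + 1) * (delta / eps) + 4 * delta) by ring.
apply: le_trans (lerD P1 P2); apply: unif_prob_subU => b _; apply: contraR.
rewrite negb_or => /andP[b_upper /negPn/existsP[j /eqP jx]].
rewrite upper // andbT.
by apply: (lower b x); [exact: truncnS_gt|exists j; rewrite jx].
Qed.

End MaxLoad.

(** * Comparison of random graphs with throws *)

Section GraphsAndThrows.
Local Open Scope ring_scope.
Variable R : realType.

(* Divided by [n ^ (2 * m)], the right-hand side is the probability that pairing
   up the [2 * m] balls yields a simple graph. *)
Lemma simple_throws_lb n m (K : R) : (0 < n)%N -> m%:R <= K * n%:R -> 0 <= K ->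
  2 * (1 + 2 * K) <= n%:R ->
  expR (- (2 * (1 + 2 * K) * K)) * (n ^ (2 * m))%:R <= ('C(n, 2) ^_ m * 2 ^ m)%:R.
Proof.
move=> n0 mK K0 nK; set s := 1 + 2 * K in nK *.
have nR : 0 < n%:R :> R by rewrite ltr0n.
have s0 : 0 < s by rewrite /s; lra.
have sn : 0 <= s / n%:R <= 1 / 2.
  by rewrite divr_ge0 ?(ltW s0) ?(ltW nR) //= ler_pdivrMr //; lra.
(* Over the reals, 2(C(n,2) - m) = n^2 - n - 2m >= n^2 (1 - s/n), and (1 - s/n)^m >= exp(-2sm/n) >=
   exp(-2sK) because s/n <= 1/2. *)
apply: (@le_trans _ _ ((('C(n, 2) - m) * 2) ^ m)%:R); last first.
  by rewrite ler_nat expnMn leq_mul2r leq_exp_ffact orbT.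
rewrite expnM !natrX -natrX; apply: (@le_trans _ _ ((n%:R ^+ 2 * (1 - s / n%:R)) ^+ m)).
  rewrite exprMn mulrC natrX ler_pM2l ?exprn_gt0 //.
  apply: (@le_trans _ _ (expR (- (2 * (s / n%:R))) ^+ m)); last first.
    by rewrite lerXn2r ?nnegrE ?expR_ge0 ?one_sub_ge_expR //; lra.
  rewrite -expRM_natl ler_expR mulrN lerN2.
  have -> : m%:R * (2 * (s / n%:R)) = 2 * s * (m%:R / n%:R) by field; rewrite gt_eqF.
  by rewrite ler_pM2l ?mulr_gt0 // ler_pdivrMr.
have hN : 'C(n, 2)%:R * 2 = n%:R * n%:R - n%:R :> R.
  have := bin_ffact n 2; rewrite ffactnS ffactn1 => /(congr1 (fun i => i%:R : R)).
  by rewrite natrM => ->; rewrite natrM -subn1 natrB // mulrBr mulr1.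
have hNm : 'C(n, 2)%:R - m%:R <= ('C(n, 2) - m)%:R :> R.
  by rewrite lerBlDr -natrD ler_nat; lia.
apply: lerXn2r; rewrite ?nnegrE //.
  by rewrite mulr_ge0 ?exprn_ge0 ?(ltW nR) //; lra.
have -> : n%:R ^+ 2 * (1 - s / n%:R) = n%:R * n%:R - s * n%:R.
  by field; rewrite gt_eqF.
rewrite natrM /s; lra.
Qed.

(** A bad graph yields m! 2^m bad throws, while all graphs together account for at least a fraction
    exp(-2(1+2K)K) of the throws. Nonemptiness is recorded so that complements can be taken
    later. *)
Lemma prob_degree_sequence_le n m (K : R) (B : pred {ffun 'I_n -> nat}) :
  (0 < n)%N -> m%:R <= K * n%:R -> 0 <= K -> 2 * (1 + 2 * K) <= n%:R ->
  (0 < #|graphs n m|)%N /\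
  unif_prob R (graphs n m) (fun E => B (degree_sequence E)) <=
  expR (2 * (1 + 2 * K) * K) * unif_prob R (throws (2 * m) n) (fun b => B (loads b)).
Proof.
move=> n0 mK K0 nK; have := simple_throws_lb n0 mK K0 nK.
rewrite -card_graphs expRN; set c := expR _.
have c0 : 0 < c by exact: expR_gt0.
have nm0 : 0 < (n ^ (2 * m))%:R :> R by rewrite ltr0n expn_gt0 n0.
move=> h; have g0 : (0 < #|graphs n m|)%N.
  rewrite lt0n; apply/eqP => g0; move: h; rewrite g0 !mul0n.
  by rewrite leNgt mulr_gt0 ?invr_gt0.
split=> //; have gR : 0 < #|graphs n m|%:R :> R by rewrite ltr0n.
have := @card_bad_graphs n m (Ordinal n0) B.
rewrite unif_prob_throws /unif_prob -(ler_nat R).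
set bad := #|[set b | B (loads b)]%SET|; set badG := #|[pred x in _ | _]|.
have -> : #|[set E in graphs n m | B (degree_sequence E)]%SET| = badG.
  by rewrite /badG cardsE; apply: eq_card => E; rewrite !inE.
have w0 : 0 < (m`! * 2 ^ m)%:R :> R by rewrite ltr0n muln_gt0 fact_gt0 expn_gt0.
rewrite -mulnA natrM in h; rewrite -mulnA natrM; move: h w0.
move: (m`! * 2 ^ m)%:R => w h w0 hb.
rewrite ler_pdivrMr // -(ler_pM2r w0) (le_trans hb) //.
set T := (n ^ (2 * m))%:R in nm0 h *; set g := #|graphs n m|%:R in gR h *.
have -> : c * (bad%:R / T) * g * w = bad%:R * (c * (g * w) / T).
  by field; rewrite gt_eqF.
rewrite ler_peMr // ler_pdivlMr // mul1r.
by rewrite mulrC ler_pdivrMr // mulrC in h.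
Qed.

End GraphsAndThrows.

(** * Passage to the limit *)

Local Open Scope ring_scope.
Local Open Scope classical_set_scope.

(** The comparison factor depends on [K] alone; applied to the complement of [I n], it carries
    failure probabilities tending to 0 from throws to graphs. *)
Lemma contiguity (R : realType) (m : nat -> nat) (K : R) (K0 : 0 <= K)
    (mK : \forall n \near \oo, (m n)%:R <= K * n%:R)
    (I : forall n, pred {ffun 'I_n -> nat}) :
  unif_prob R (throws (2 * m n) n) (fun b => I n (loads b))
    @[n --> \oo] --> (1 : R) ->
  unif_prob R (graphs n (m n)) (fun E => I n (degree_sequence E))
    @[n --> \oo] --> (1 : R).
Proof.
move=> /cvgrPdist_le cvgT; apply/cvgrPdist_le => e e0.
pose c : R := expR (2 * (1 + 2 * K) * K).
have c0 : 0 < c by exact: expR_gt0.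
near=> n.
have n0 : (0 < n)%N by near: n; exact: nbhs_infty_ge.
have mKn : (m n)%:R <= K * n%:R by near: n.
have nK : 2 * (1 + 2 * K) <= n%:R by near: n; exact: nbhs_infty_ger.
have [g0 bound] := prob_degree_sequence_le (fun d => ~~ I n d) n0 mKn K0 nK.
have T0 : (0 < #|throws (2 * m n) n|)%N by rewrite card_throws expn_gt0 n0.
rewrite (@unif_probC R _ _ _ g0) subKr ger0_norm ?unif_prob_ge0 //.
apply: (le_trans bound); rewrite -/c mulrC -ler_pdivlMr //.
have : `|1 - unif_prob R (throws (2 * m n) n) (fun b => I n (loads b))| <= e / c.
  by near: n; apply: cvgT; rewrite divr_gt0.
by rewrite (@unif_probC R _ _ _ T0) subKr ger0_norm ?unif_prob_ge0.
Unshelve. all: by end_near. Qed.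

Lemma near_ln_ge (R : realType) (A : R) : \forall n \near \oo, A <= ln n%:R.
Proof.
near=> n; rewrite -[leLHS]expRK ler_ln ?posrE ?expR_gt0 //.
  by near: n; exact: nbhs_infty_ger.
by rewrite ltr0n; near: n; exact: nbhs_infty_ge.
Unshelve. all: by end_near. Qed.

Lemma max_load_cvg (R : realType) (k : nat -> nat) (K : R) (K1 : 1 <= K)
    (k_gt0 : forall n, (0 < k n)%N)
    (kK : \forall n \near \oo, (k n)%:R <= K * n%:R) (eps : R) (eps_gt0 : 0 < eps) :
  unif_prob R (throws (k n) n)
    (fun b => Num.floor (nu R n (k n) - eps) <= (\max_j loads b j)%N%:Z
                <= Num.floor (nu R n (k n) + eps))
    @[n --> \oo] --> (1 : R).
Proof.
apply/cvgrPdist_le => e e0.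
pose C : R := (1 + 2 * expR (2 * K + 1)) / eps + 4.
have C0 : 0 < C by rewrite addr_gt0 // divr_gt0 // addr_gt0 // mulr_gt0 ?expR_gt0.
(* The three bounds secure 4 delta <= 1, delta <= eps and delta C <= e, where delta C is the error
   in [max_load_concentration]. *)
pose delta := Num.min 4^-1 (Num.min eps (e / C)).
have d0 : 0 < delta by rewrite !lt_min invr_gt0 eps_gt0 divr_gt0 //= ltr0n.
have d1 : 4 * delta <= 1.
  have : delta <= 4^-1 by rewrite ge_min lexx.
  lra.
have de : delta <= eps by rewrite !ge_min lexx orbT.
have dC : delta * C <= e by rewrite -ler_pdivlMr // !ge_min lexx !orbT.
near=> n.
have n1 : (1 < n)%N by near: n; exact: nbhs_infty_ge.
have kKn : (k n)%:R <= K * n%:R by near: n.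
have hK : expR (ln K + 1 + delta^-1) <= delta * ln n%:R.
  by rewrite mulrC -ler_pdivrMr //; near: n; exact: near_ln_ge.
have ln480 : 480 <= ln (n%:R : R) by near: n; exact: near_ln_ge.
have T0 : (0 < #|throws (k n) n|)%N by rewrite card_throws expn_gt0 (ltnW n1).
rewrite (@unif_probC R _ _ _ T0) subKr ger0_norm ?unif_prob_ge0 //.
apply: le_trans (max_load_concentration n1 (k_gt0 n) kKn K1 eps_gt0 d0 d1 de hK ln480) _.
apply: le_trans dC; rewrite /C.
by have -> : forall a : R, a * (delta / eps) + 4 * delta = delta * (a / eps + 4) by move=> a; ring.
Unshelve. all: by end_near. Qed.

Theorem theorem5p1 (R : realType) (m : nat -> nat)
    (m_gt0 : forall n, (0 < m n)%N)
    (mO : (fun n => (m n)%:R : R) =O_\oo (fun n => n%:R : R))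
    (eps : R) (eps_gt0 : 0 < eps) :
  (forall I : forall n, pred {ffun 'I_n -> nat},
     (forall n (d : {ffun 'I_n -> nat}), I n d ->
        forall j, (d j <= 2 * m n)%N) ->
     unif_prob R (throws (2 * m n) n) (fun b => I n (loads b))
       @[n --> \oo] --> (1 : R) ->
     unif_prob R (graphs n (m n)) (fun E => I n (degree_sequence E))
       @[n --> \oo] --> (1 : R))
  /\
  unif_prob R (graphs n (m n))
    (fun E => Num.floor (nu R n (2 * m n) - eps) <= (max_degree E)%:Z
                <= Num.floor (nu R n (2 * m n) + eps))
    @[n --> \oo] --> (1 : R).
Proof.
have [K K0 mK] : exists2 K : R, 0 < K & \forall n \near \oo, (m n)%:R <= K * n%:R.
  have /eqO_exP[K K0 mK] := mO; exists K => //.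
  by apply: filterS mK => n; rewrite !normr_nat.
split=> [I _|]; first exact: (@contiguity R m K (ltW K0) mK I).
(* Part (ii) is an event about the degree sequence, so it transfers from the loads by
   [contiguity]. *)
pose J n : pred {ffun 'I_n -> nat} := fun d =>
  Num.floor (nu R n (2 * m n) - eps) <= (\max_j d j)%N%:Z
    <= Num.floor (nu R n (2 * m n) + eps).
have -> : (fun n => unif_prob R (graphs n (m n))
    (fun E => Num.floor (nu R n (2 * m n) - eps) <= (max_degree E)%:Z
                <= Num.floor (nu R n (2 * m n) + eps))) =
    (fun n => unif_prob R (graphs n (m n)) (fun E => J n (degree_sequence E))).
  apply/funext => n; congr unif_prob; apply/funext => E; rewrite /J.
  have -> // : max_degree E = (\max_j degree_sequence E j)%N.
  by apply: eq_bigr => v _; rewrite ffunE.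
apply: (@contiguity R m K (ltW K0) mK J).
(* From m <= K n follows 2m <= 2K n; the added 1 makes the constant at least 1, as [max_load_cvg]
   requires. *)
apply: (@max_load_cvg R (fun n => 2 * m n)%N (2 * K + 1)) => //; first by lra.
  by move=> n; rewrite muln_gt0 m_gt0.
apply: filterS mK => n mKn; rewrite natrM.
have : 0 <= n%:R :> R by [].
lra.
Qed.
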